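(* Let $\Delta$ be the augmented simplex category, generated by the objects $[n]$ ($n\ge 0$), the face maps $\bar\delta^i_n\colon[n]\to[n+1]$ ($n\ge 0$, $0\le i\le n$) and the degeneracy maps $\bar\sigma^i_n\colon[n+1]\to[n]$ ($n\ge 1$, $0\le i<n$), and let $\bar\Delta=\Delta[\alpha^{-1}]$ be the category obtained by formally inverting the morphism $\alpha=\bar\delta_0^0\colon[0]\to[1]$. Let $\Sigma$ be the category of connected strings. The assignments $$[0]\mapsto\Sigma_0,\qquad [n]\mapsto\Sigma_{n-1}\ (n>0),\qquad \bar\delta_n^i\mapsto\delta_n^i\ (n\ge 1),\qquad \bar\delta_0^0\mapsto\mathrm{id},\qquad \bar\sigma_n^i\mapsto\sigma_n^i\ (n\ge 1)$$ provide a functor $p\colon\Delta\to\Sigma$ which induces an equivalence $\bar\Delta\to\Sigma$.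
   Context: $\Delta$: the objects are the finite ordinals $[n]=\{0,1,\dots,n-1\}$, $n\in\mathbb N=\{0,1,2,\dots\}$; the morphisms $[m]\to[n]$ are the weakly order-preserving maps. $\bar\delta_n^i$ is the unique injective morphism $[n]\to[n+1]$ not taking the value $i$; $\bar\sigma_n^i$ is the unique surjective morphism $[n+1]\to[n]$ taking the value $i$ twice. Strings. A basic string is a pair $s=(s',s'')$ of integers with $s'\le s''$; in addition there is the zero string $*$. Put $s_i:=(i,i)$ (simple strings). The product of strings is: $st=(s',t'')$ if $s=(s',s'')$, $t=(t',t'')$ and $s''+1=t'$; $st=t$ if $s=*$; $st=s$ if $t=*$; and $st=*$ otherwise. For $n\in\mathbb N$ let $\Sigma_n=\{(s',s'')\mid 0\le s'\le s''<n\}\cup\{*\}$ (the connected string of length $n$). A morphism $\phi\colon\Sigma_m\to\Sigma_n$ is a map such that for all $s,t\in\Sigma_m$ one has $\phi(st)=\phi(s)\phi(t)$, and such that $st\neq *=\phi(st)$ implies $\phi(s)=*=\phi(t)$. The category $\Sigma$ has objects $\Sigma_n$, $n\in\mathbb N$, and these morphisms, composed as maps. A morphism is determined by its values on simple strings. Standard morphisms, for $n\ge 1$: $\delta_n^i\colon\Sigma_{n-1}\to\Sigma_n$ ($0\le i\le n$) is given by the unique injective map such that $s_{i-1}$ and $s_i$ are not in its image; thus $\delta_n^i(s_j)=s_j$ for $j<i-1$, $\delta_n^i(s_j)=(j,j+1)$ for $j=i-1$, and $\delta_n^i(s_j)=s_{j+1}$ for $j>i-1$. $\sigma_n^i\colon\Sigma_n\to\Sigma_{n-1}$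 ($0\le i<n$) is given by the unique surjective map such that $s_i$ is sent to the zero string; thus $\sigma_n^i(s_j)=s_j$ for $j<i$, $\sigma_n^i(s_i)=*$, and $\sigma_n^i(s_j)=s_{j-1}$ for $j>i$.
   Formalization: A morphism of strings must satisfy φ(st)=φ(s)φ(t) only if s=*, t=* or s''+1=t', not for all s,t: otherwise σ_2^0 is no morphism, since s_1s_0=* but σ_2^0(s_1)σ_2^0(s_0)=s_0≠*. *)

(* Defs.v *)
From HB Require Import structures.
From mathcomp Require Import all_boot generic_quotient boolp zify.

Set Implicit Arguments.
Unset Strict Implicit.
Unset Printing Implicit Defensive.

Local Open Scope quotient_scope.

Record category := Category {
  obj :> Type;
  hom : obj -> obj -> Type;
  idm : forall x, hom x x;
  comp : forall x y z, hom y z -> hom x y -> hom x z;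
  comp_idl : forall x y (f : hom x y), comp (idm y) f = f;
  comp_idr : forall x y (f : hom x y), comp f (idm x) = f;
  comp_assoc : forall x y z t (h : hom z t) (g : hom y z) (f : hom x y),
    comp h (comp g f) = comp (comp h g) f
}.
Arguments hom {c} x y.
Arguments idm {c} x.
Arguments comp {c x y z} g f.

Definition is_iso (C : category) (x y : C) (f : hom x y) : Prop :=
  exists g : hom y x, comp g f = idm x /\ comp f g = idm y.

(* [is_functor F1]: the family [F1] of maps on morphisms is a functor with
   object map [F0]; keeping [F0] as an index allows one to prescribe it up to
   conversion, so that no transport of morphisms is needed. *)
Definition is_functor (C D : category) (F0 : C -> D)
    (F1 : forall x y, hom x y -> hom (F0 x) (F0 y)) : Prop :=
  (forall x, F1 x x (idm x) = idm (F0 x)) /\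
  (forall x y z (g : hom y z) (f : hom x y),
     F1 x z (comp g f) = comp (F1 y z g) (F1 x y f)).

Record functor (C D : category) := Functor {
  fobj :> C -> D;
  fmap : forall x y, hom x y -> hom (fobj x) (fobj y);
  fmapP : is_functor fmap
}.
Arguments fmap {C D} f {x y} _.

Lemma id_functor_subproof (C : category) :
  @is_functor C C id (fun _ _ f => f).
Proof. by split. Qed.

Definition id_functor (C : category) : functor C C :=
  Functor (id_functor_subproof C).

Lemma comp_functor_subproof (C D E : category)
    (G : functor D E) (F : functor C D) :
  @is_functor C E (fun x => G (F x)) (fun x y f => fmap G (fmap F f)).
Proof.
case: (fmapP F) (fmapP G) => [F_id F_comp] [G_id G_comp].
by split=> [x | x y z g f]; rewrite ?F_id ?G_id ?F_comp ?G_comp.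
Qed.

Definition comp_functor (C D E : category)
    (G : functor D E) (F : functor C D) : functor C E :=
  Functor (comp_functor_subproof G F).

Definition nat_isomorphic (C D : category) (F G : functor C D) : Prop :=
  exists eta : forall x, hom (F x) (G x),
    (forall x, is_iso (eta x)) /\
    (forall x y (f : hom x y),
       comp (eta y) (fmap F f) = comp (fmap G f) (eta x)).

Definition is_equivalence (C D : category) (F : functor C D) : Prop :=
  exists G : functor D C,
    nat_isomorphic (comp_functor G F) (id_functor C) /\
    nat_isomorphic (comp_functor F G) (id_functor D).

(* The category C[alpha^-1]: same objects as C, and as morphisms the formal
   composites of morphisms of C and of a symbol alpha^-1 : b -> a, modulo the
   congruence generated by the category laws, the composition and identities
   of C, and alpha^-1 alpha = 1, alpha alpha^-1 = 1. *)
Inductive word (C : category) (a b : C) : C -> C -> Type :=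
| wgen x y : hom x y -> word a b x y
| winv : word a b b a
| wcomp x y z : word a b y z -> word a b x y -> word a b x z.
Arguments wgen {C} a b {x y} _.
Arguments winv {C} a b.

Inductive weq (C : category) (a b : C) (alpha : hom a b) :
    forall x y, word a b x y -> word a b x y -> Prop :=
| weq_refl x y (u : word a b x y) : weq alpha u u
| weq_sym x y (u v : word a b x y) : weq alpha u v -> weq alpha v u
| weq_trans x y (u v w : word a b x y) :
    weq alpha u v -> weq alpha v w -> weq alpha u w
| weq_congr x y z (u u' : word a b y z) (v v' : word a b x y) :
    weq alpha u u' -> weq alpha v v' ->
    weq alpha (wcomp u v) (wcomp u' v')
| weq_idl x y (u : word a b x y) :
    weq alpha (wcomp (wgen a b (idm y)) u) u
| weq_idr x y (u : word a b x y) :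
    weq alpha (wcomp u (wgen a b (idm x))) u
| weq_assoc x y z t
    (w : word a b z t) (v : word a b y z) (u : word a b x y) :
    weq alpha (wcomp w (wcomp v u)) (wcomp (wcomp w v) u)
| weq_gen x y z (g : hom y z) (f : hom x y) :
    weq alpha (wgen a b (comp g f)) (wcomp (wgen a b g) (wgen a b f))
| weq_invl :
    weq alpha (wcomp (winv a b) (wgen a b alpha)) (wgen a b (idm a))
| weq_invr :
    weq alpha (wcomp (wgen a b alpha) (winv a b)) (wgen a b (idm b)).

Definition weqb (C : category) (a b : C) (alpha : hom a b) (x y : C) :
    rel {classic (word a b x y)} :=
  fun u v => `[< weq alpha u v >].

Lemma weqb_refl (C : category) (a b : C) (alpha : hom a b) (x y : C) :
  reflexive (@weqb C a b alpha x y).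
Proof. by move=> u; apply/asboolP; exact: weq_refl. Qed.

Lemma weqb_sym (C : category) (a b : C) (alpha : hom a b) (x y : C) :
  symmetric (@weqb C a b alpha x y).
Proof. by move=> u v; apply/asboolP/asboolP; exact: weq_sym. Qed.

Lemma weqb_trans (C : category) (a b : C) (alpha : hom a b) (x y : C) :
  transitive (@weqb C a b alpha x y).
Proof.
by move=> v u w /asboolP uv /asboolP vw; apply/asboolP; exact: weq_trans vw.
Qed.

Canonical weqb_equiv (C : category) (a b : C) (alpha : hom a b) (x y : C) :=
  EquivRel (@weqb C a b alpha x y) (@weqb_refl C a b alpha x y)
    (@weqb_sym C a b alpha x y) (@weqb_trans C a b alpha x y).

Definition loc_hom (C : category) (a b : C) (alpha : hom a b) (x y : C) :
    Type :=
  {eq_quot (@weqb C a b alpha x y)}.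

Definition loc_class (C : category) (a b : C) (alpha : hom a b) (x y : C)
    (u : word a b x y) : loc_hom alpha x y :=
  \pi_({eq_quot (@weqb C a b alpha x y)}) u.

Definition loc_repr (C : category) (a b : C) (alpha : hom a b) (x y : C)
    (q : loc_hom alpha x y) : word a b x y := repr q.

Lemma loc_reprK (C : category) (a b : C) (alpha : hom a b) (x y : C)
    (q : loc_hom alpha x y) : loc_class alpha (loc_repr q) = q.
Proof. exact: reprK. Qed.

Lemma loc_classP (C : category) (a b : C) (alpha : hom a b) (x y : C)
    (u v : word a b x y) :
  loc_class alpha u = loc_class alpha v <-> weq alpha u v.
Proof.
by split=> [/eqmodP/asboolP | uv] //; apply/eqmodP/asboolP.
Qed.

Definition loc_comp (C : category) (a b : C) (alpha : hom a b) (x y z : C)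
    (q : loc_hom alpha y z) (r : loc_hom alpha x y) : loc_hom alpha x z :=
  loc_class alpha (wcomp (loc_repr q) (loc_repr r)).

Lemma loc_compE (C : category) (a b : C) (alpha : hom a b) (x y z : C)
    (u : word a b y z) (v : word a b x y) :
  loc_comp (loc_class alpha u) (loc_class alpha v) =
  loc_class alpha (wcomp u v).
Proof.
by apply/loc_classP; apply: weq_congr; apply/loc_classP; exact: loc_reprK.
Qed.

Definition loc_id (C : category) (a b : C) (alpha : hom a b) (x : C) :
    loc_hom alpha x x := loc_class alpha (wgen a b (idm x)).

Lemma loc_idl (C : category) (a b : C) (alpha : hom a b) (x y : C)
    (q : loc_hom alpha x y) : loc_comp (loc_id alpha y) q = q.
Proof.
by rewrite -[q]loc_reprK loc_compE; apply/loc_classP; exact: weq_idl.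
Qed.

Lemma loc_idr (C : category) (a b : C) (alpha : hom a b) (x y : C)
    (q : loc_hom alpha x y) : loc_comp q (loc_id alpha x) = q.
Proof.
by rewrite -[q]loc_reprK loc_compE; apply/loc_classP; exact: weq_idr.
Qed.

Lemma loc_assoc (C : category) (a b : C) (alpha : hom a b) (x y z t : C)
    (s : loc_hom alpha z t) (r : loc_hom alpha y z) (q : loc_hom alpha x y) :
  loc_comp s (loc_comp r q) = loc_comp (loc_comp s r) q.
Proof.
rewrite -[q]loc_reprK -[r]loc_reprK -[s]loc_reprK !loc_compE.
by apply/loc_classP; exact: weq_assoc.
Qed.

Definition localization (C : category) (a b : C) (alpha : hom a b) : category :=
  @Category C (loc_hom alpha) (loc_id alpha) (@loc_comp C a b alpha)
    (@loc_idl C a b alpha) (@loc_idr C a b alpha) (@loc_assoc C a b alpha).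

(* The morphism part of the canonical functor C -> C[alpha^-1], which is the
   identity on objects. *)
Definition loc_map (C : category) (a b : C) (alpha : hom a b) (x y : C)
    (f : hom x y) : @hom (localization alpha) x y :=
  loc_class alpha (wgen a b f).

Lemma loc_map_functor (C : category) (a b : C) (alpha : hom a b) :
  @is_functor C (localization alpha) id (@loc_map C a b alpha).
Proof.
split=> // x y z g f; rewrite /loc_map /= loc_compE.
by apply/loc_classP; exact: weq_gen.
Qed.

Lemma loc_map_iso (C : category) (a b : C) (alpha : hom a b) :
  is_iso (loc_map alpha alpha).
Proof.
exists (loc_class alpha (winv a b)); rewrite /loc_map /= !loc_compE.
by split; apply/loc_classP; [exact: weq_invl | exact: weq_invr].
Qed.

Definition order_preserving (m n : nat) (f : {ffun 'I_m -> 'I_n}) : bool :=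
  [forall i : 'I_m, forall j : 'I_m, (i <= j) ==> (f i <= f j)].

Definition order_map (m n : nat) :=
  {f : {ffun 'I_m -> 'I_n} | order_preserving f}.

Lemma order_mapP (m n : nat) (f : {ffun 'I_m -> 'I_n}) :
  reflect (forall i j : 'I_m, i <= j -> f i <= f j)
    (order_preserving f).
Proof.
apply: (iffP forallP) => [mono i j | mono i].
  by have /forallP/(_ j)/implyP := mono i.
by apply/forallP => j; apply/implyP; exact: mono.
Qed.

Lemma order_map_id_subproof (n : nat) :
  let f := [ffun i : 'I_n => i] in
  order_preserving f.
Proof. by apply/order_mapP => i j; rewrite !ffunE. Qed.

Definition order_map_id (n : nat) : order_map n n :=
  exist (fun f => order_preserving f) _ (order_map_id_subproof n).

Lemma order_map_comp_subproof (l m n : nat)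
    (g : order_map m n) (f : order_map l m) :
  let h := [ffun i => val g (val f i)] in
  order_preserving h.
Proof.
apply/order_mapP => i j le_ij; rewrite !ffunE.
by apply: (order_mapP _ (valP g)); apply: (order_mapP _ (valP f)).
Qed.

Definition order_map_comp (l m n : nat)
    (g : order_map m n) (f : order_map l m) : order_map l n :=
  exist (fun f => order_preserving f) _ (order_map_comp_subproof g f).

Lemma order_map_idl (m n : nat) (f : order_map m n) :
  order_map_comp (order_map_id n) f = f.
Proof. by apply/val_inj/ffunP => i; rewrite !ffunE. Qed.

Lemma order_map_idr (m n : nat) (f : order_map m n) :
  order_map_comp f (order_map_id m) = f.
Proof. by apply/val_inj/ffunP => i; rewrite !ffunE. Qed.

Lemma order_map_assoc (k l m n : nat)
    (h : order_map m n) (g : order_map l m) (f : order_map k l) :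
  order_map_comp h (order_map_comp g f) =
  order_map_comp (order_map_comp h g) f.
Proof. by apply/val_inj/ffunP => i; rewrite !ffunE. Qed.

(* The augmented simplex category; the object [n] = {0, ..., n-1} is encoded
   by the natural number n. *)
Definition Delta : category :=
  Category order_map_idl order_map_idr order_map_assoc.

Lemma face_subproof (n : nat) (i : 'I_n.+1) :
  let f := [ffun j : 'I_n => lift i j] in
  order_preserving f.
Proof. by apply/order_mapP => j k; rewrite !ffunE /= leq_bump2. Qed.

Definition face (n : nat) (i : 'I_n.+1) : @hom Delta n n.+1 :=
  exist (fun f => order_preserving f) _ (face_subproof i).

Lemma degen_ord_subproof (n : nat) (i : 'I_n) (j : 'I_n.+1) :
  (if j <= i then j : nat else j.-1) < n.
Proof. by have := ltn_ord i; have := ltn_ord j; case: ifP; lia. Qed.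

Lemma degen_subproof (n : nat) (i : 'I_n) :
  let f := [ffun j : 'I_n.+1 => Ordinal (degen_ord_subproof i j)] in
  order_preserving f.
Proof.
by apply/order_mapP => j k; rewrite !ffunE /=; case: ifP; case: ifP; lia.
Qed.

Definition degen (n : nat) (i : 'I_n) : @hom Delta n.+1 n :=
  exist (fun f => order_preserving f) _ (degen_subproof i).

(* [conn_string n] is Sigma_n; [None] is the zero string. *)
Definition basic_string (n : nat) := {s : 'I_n * 'I_n | s.1 <= s.2}.
Definition conn_string (n : nat) := option (basic_string n).

(* The basic string (a, b) of Sigma_n; the value outside of the range
   a <= b < n is irrelevant, and taken to be *. *)
Definition str (n a b : nat) : conn_string n :=
  match insub a : option 'I_n, insub b : option 'I_n with
  | Some a', Some b' => insub (a', b')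
  | _, _ => None
  end.

Definition simple (n : nat) (i : 'I_n) : conn_string n := str n i i.

Definition smul (n : nat) (s t : conn_string n) : conn_string n :=
  match s, t with
  | None, _ => t
  | _, None => s
  | Some s, Some t =>
      if (val s).2.+1 == (val t).1 then str n (val s).1 (val t).2 else None
  end.

(* s t is given by one of the first three clauses in the definition of the
   product: it is not * merely because s and t do not match up. *)
Definition composable (n : nat) (s t : conn_string n) : bool :=
  match s, t with
  | Some s, Some t => (val s).2.+1 == (val t).1
  | _, _ => true
  end.

(* Multiplicativity is required for the products that are defined.  Requiring
   phi (s t) = phi s phi t also for basic strings with s'' + 1 <> t' would
   exclude the maps [sdegen] below: if phi s_i = * and j < i, then s_i s_j = *,
   whereas phi s_i phi s_j = phi s_j is basic.  The case s = t = * of the first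
   condition yields phi * = *. *)
Definition is_string_morphism (m n : nat)
    (phi : {ffun conn_string m -> conn_string n}) : bool :=
  [forall s, forall t,
     composable s t ==> (phi (smul s t) == smul (phi s) (phi t))] &&
  [forall s, forall t,
     (smul s t != None) && (phi (smul s t) == None) ==>
     (phi s == None) && (phi t == None)].

Definition string_morphism (m n : nat) :=
  {phi : {ffun conn_string m -> conn_string n} | is_string_morphism phi}.

Lemma is_string_morphismP (m n : nat)
    (phi : {ffun conn_string m -> conn_string n}) :
  reflect
    ((forall s t, composable s t -> phi (smul s t) = smul (phi s) (phi t)) /\
     (forall s t, smul s t <> None -> phi (smul s t) = None ->
        phi s = None /\ phi t = None))
    (is_string_morphism phi).
Proof.
apply: (iffP andP) => -[mulP zeroP].
  split=> s t.
    move=> st; apply/eqP.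
    by have /forallP/(_ t)/implyP := forallP mulP s; apply.
  move=> /eqP st /eqP phi_st; have /forallP/(_ t)/implyP := forallP zeroP s.
  by rewrite st phi_st => /(_ isT)/andP[/eqP-> /eqP->].
split; apply/forallP => s; apply/forallP => t; apply/implyP.
  by move=> st; apply/eqP/mulP.
by move=> /andP[/eqP st /eqP phi_st]; have [-> ->] := zeroP s t st phi_st.
Qed.

Lemma strE (n a b : nat) (le_ab : a <= b) (lt_bn : b < n) :
  str n a b =
  Some (exist (fun s : 'I_n * 'I_n => s.1 <= s.2)
          (Ordinal (leq_ltn_trans le_ab lt_bn), Ordinal lt_bn) le_ab).
Proof.
by rewrite /str (insubT (fun i => i < n) (leq_ltn_trans le_ab lt_bn))
  (insubT (fun i => i < n) lt_bn) /= insubT.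
Qed.

Lemma conn_stringP (n : nat) (s : conn_string n) :
  s = None \/ exists a b, [/\ a <= b, b < n & s = str n a b].
Proof.
case: s => [[[a b] /= le_ab]|]; [right | by left].
exists a, b; split=> //; rewrite (strE le_ab (ltn_ord b)).
by congr Some; apply/val_inj; congr pair; exact/val_inj.
Qed.

Lemma str_inj (n a b c d : nat) : a <= b -> b < n -> c <= d -> d < n ->
  str n a b = str n c d -> a = c /\ b = d.
Proof. by move=> ? ? ? ?; rewrite !strE => -[]. Qed.

Lemma str_neq0 (n a b : nat) : a <= b -> b < n -> str n a b <> None.
Proof. by move=> ? ?; rewrite strE. Qed.

Lemma smul0s (n : nat) (s : conn_string n) : smul None s = s.
Proof. by []. Qed.

Lemma smuls0 (n : nat) (s : conn_string n) : smul s None = s.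
Proof. by case: s. Qed.

Lemma smul_str (n a b c d : nat) : a <= b -> b < n -> c <= d -> d < n ->
  smul (str n a b) (str n c d) = if b.+1 == c then str n a d else None.
Proof. by move=> ab bn cd dn; rewrite (strE ab bn) (strE cd dn). Qed.

Lemma composable_str (n a b c d : nat) : a <= b -> b < n -> c <= d -> d < n ->
  composable (str n a b) (str n c d) = (b.+1 == c).
Proof. by move=> ab bn cd dn; rewrite (strE ab bn) (strE cd dn). Qed.

Lemma smul_composable (n : nat) (s t : conn_string n) :
  smul s t <> None -> composable s t.
Proof. by case: s t => [s|] [t|] //=; case: ifP. Qed.

Lemma composable_neq0 (n : nat) (s t : conn_string n) :
  composable s t -> smul s t = None -> s = None /\ t = None.
Proof.
have [-> | [a [b [ab bn ->]]]] := conn_stringP s; first by rewrite smul0s.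
have [-> | [c [d [cd dn ->]]]] := conn_stringP t; first by rewrite smuls0.
rewrite composable_str ?smul_str // => /eqP bc; rewrite bc eqxx.
by move/str_neq0; case; lia.
Qed.

Lemma string_morphism0 (m n : nat)
    (phi : {ffun conn_string m -> conn_string n}) :
  is_string_morphism phi -> phi None = None.
Proof.
case/is_string_morphismP => /(_ None None isT) /= + _.
case: (conn_stringP (phi None)) => // -[a [b [ab bn ->]]].
rewrite smul_str //; case: eqP => [|_] // ; lia.
Qed.

(* The second condition is what makes the first one stable under
   composition. *)
Lemma string_morphism_composable (m n : nat)
    (phi : {ffun conn_string m -> conn_string n}) (s t : conn_string m) :
  is_string_morphism phi -> composable s t -> composable (phi s) (phi t).
Proof.
move=> phiP st; have phi0 := string_morphism0 phiP.
case: (pselect (phi s = None)) => [-> // | phi_s].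
case: (pselect (phi t = None)) => [-> | phi_t]; first by case: (phi s).
case/is_string_morphismP: phiP => mulP zeroP.
have st_neq0 : smul s t <> None.
  by move=> /(composable_neq0 st) [s0 _]; apply: phi_s; rewrite s0.
apply: smul_composable; rewrite -mulP // => /(zeroP _ _ st_neq0) [phi_s0 _].
exact: phi_s.
Qed.

Lemma string_morphism_id_subproof (n : nat) :
  is_string_morphism [ffun s : conn_string n => s].
Proof. by apply/is_string_morphismP; split=> s t; rewrite !ffunE. Qed.

Definition string_morphism_id (n : nat) : string_morphism n n :=
  exist (fun phi => is_string_morphism phi) _ (string_morphism_id_subproof n).

Lemma string_morphism_comp_subproof (l m n : nat)
    (psi : string_morphism m n) (phi : string_morphism l m) :
  is_string_morphism [ffun s => val psi (val phi s)].
Proof.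
have [psiP phiP] := (valP psi, valP phi).
case/is_string_morphismP: (psiP) => psi_mul psi_zero.
case/is_string_morphismP: (phiP) => phi_mul phi_zero.
apply/is_string_morphismP; split=> s t; rewrite !ffunE.
  move=> st; rewrite phi_mul // psi_mul //.
  exact: string_morphism_composable.
move=> st; case: (pselect (val phi (smul s t) = None)) => [phi_st _ | phi_st].
  have [-> ->] := phi_zero _ _ st phi_st.
  by rewrite (string_morphism0 psiP).
by rewrite phi_mul; [apply: psi_zero; rewrite -phi_mul | ];
  rewrite // smul_composable.
Qed.

Lemma string_morphism_ext (m n : nat) (phi psi : string_morphism m n) :
  (forall i, val phi (simple i) = val psi (simple i)) -> phi = psi.
Proof.
move=> eq_simple; apply/val_inj/ffunP => s.
have [phiP psiP] := (valP phi, valP psi).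
have [-> | [a [b [ab bm ->]]]] := conn_stringP s.
  by rewrite !string_morphism0.
elim: b ab bm => [|b IHb] ab bm.
  by move: ab; rewrite leqn0 => /eqP->; exact: eq_simple (Ordinal bm).
move: ab; rewrite leq_eqVlt => /orP[/eqP-> | ab].
  exact: eq_simple (Ordinal bm).
have ltbm : b < m by lia.
have -> : str m a b.+1 = smul (str m a b) (simple (Ordinal bm)).
  by rewrite /simple smul_str ?eqxx.
have cab : composable (str m a b) (simple (Ordinal bm)).
  by rewrite /simple composable_str.
case/is_string_morphismP: phiP => phi_mul _.
case/is_string_morphismP: psiP => psi_mul _.
by rewrite phi_mul // psi_mul // IHb // eq_simple.
Qed.

Definition string_morphism_comp (l m n : nat)
    (psi : string_morphism m n) (phi : string_morphism l m) :
    string_morphism l n :=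
  exist (fun phi => is_string_morphism phi) _
    (string_morphism_comp_subproof psi phi).

Lemma string_morphism_idl (m n : nat) (phi : string_morphism m n) :
  string_morphism_comp (string_morphism_id n) phi = phi.
Proof. by apply/val_inj/ffunP => s; rewrite !ffunE. Qed.

Lemma string_morphism_idr (m n : nat) (phi : string_morphism m n) :
  string_morphism_comp phi (string_morphism_id m) = phi.
Proof. by apply/val_inj/ffunP => s; rewrite !ffunE. Qed.

Lemma string_morphism_assoc (k l m n : nat) (chi : string_morphism m n)
    (psi : string_morphism l m) (phi : string_morphism k l) :
  string_morphism_comp chi (string_morphism_comp psi phi) =
  string_morphism_comp (string_morphism_comp chi psi) phi.
Proof. by apply/val_inj/ffunP => s; rewrite !ffunE. Qed.

(* The object Sigma_n is encoded by the natural number n. *)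
Definition Sigma : category :=
  Category string_morphism_idl string_morphism_idr string_morphism_assoc.

(* The endpoints of the image of (a, b) under [sface i] are the first endpoint
   of the image of s_a and the last endpoint of the image of s_b; see
   [sface_simple] for the values on simple strings. *)
Definition sface_fun (n : nat) (i : 'I_n.+2) (s : conn_string n) :
    conn_string n.+1 :=
  if s is Some s then
    str n.+1 (if (val s).1 < i then (val s).1 : nat else (val s).1.+1)
             (if (val s).2.+1 < i then (val s).2 : nat else (val s).2.+1)
  else None.

Lemma sface_funE (n : nat) (i : 'I_n.+2) (a b : nat) : a <= b -> b < n ->
  sface_fun i (str n a b) =
  str n.+1 (if a < i then a else a.+1) (if b.+1 < i then b else b.+1).
Proof. by move=> ab bn; rewrite (strE ab bn). Qed.

Local Ltac lia_if := repeat (case: ifP => ?); lia.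

Lemma string_morphism_str (m n : nat) (f : conn_string m -> conn_string n) :
  f None = None ->
  (forall a b c, a <= b -> b < c -> c < m ->
     f (str m a c) = smul (f (str m a b)) (f (str m b.+1 c)) /\
     (f (str m a c) = None -> f (str m a b) = None /\ f (str m b.+1 c) = None))
  -> is_string_morphism (finfun f).
Proof.
move=> f0 f_str; apply/is_string_morphismP; split=> s t; rewrite !ffunE.
  have [-> | [a [b [ab bn ->]]]] := conn_stringP s; first by rewrite f0.
  have [-> | [c [d [cd dn ->]]]] := conn_stringP t.
    by rewrite f0 !smuls0.
  rewrite composable_str ?smul_str // => /eqP bc; rewrite bc eqxx; subst c.
  by have [] := f_str a b d.
have [-> | [a [b [ab bn ->]]]] := conn_stringP s; first by rewrite f0.
have [-> | [c [d [cd dn ->]]]] := conn_stringP t; first by rewrite f0 smuls0.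
by rewrite smul_str //; case: eqP => // bc _; subst c; have [] := f_str a b d.
Qed.

Lemma sface_subproof (n : nat) (i : 'I_n.+2) :
  is_string_morphism (finfun (sface_fun i)).
Proof.
apply: string_morphism_str => // a b c ab bc cn.
have lt_in := ltn_ord i.
rewrite !sface_funE; try lia.
split; last by move/str_neq0; case; lia_if.
rewrite smul_str; try by lia_if.
by case: eqP => //; lia_if.
Qed.

Definition sface (n : nat) (i : 'I_n.+2) : @hom Sigma n n.+1 :=
  exist (fun phi => is_string_morphism phi) _ (sface_subproof i).

Lemma sface_simple (n : nat) (i : 'I_n.+2) (j : 'I_n) :
  val (sface i) (simple j) =
  if j.+1 < i then str n.+1 j j
  else if j.+1 == i then str n.+1 j j.+1
  else str n.+1 j.+1 j.+1.
Proof.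
rewrite ffunE sface_funE //.
by case: (ltngtP j.+1 i) => [ltji | ltij | eqji]; congr str; lia_if.
Qed.

Lemma sface_inj (n : nat) (i : 'I_n.+2) : injective (val (sface i)).
Proof.
move=> s t; rewrite !ffunE.
have [-> | [a [b [ab bn ->]]]] := conn_stringP s;
have [-> | [c [d [cd dn ->]]]] := conn_stringP t; rewrite ?sface_funE //.
- by move/esym/str_neq0; case; lia_if.
- by move/str_neq0; case; lia_if.
move/str_inj => [||||+ +]; try by lia_if.
by move=> ac bd; congr str; move: ac bd; lia_if.
Qed.

(* The endpoints of the image of (a, b) are obtained by dropping s_i from the
   product s_a ... s_b and shifting the indices larger than i; see
   [sdegen_simple] for the values on simple strings. *)
Definition sdegen_fun (n : nat) (i : 'I_n.+1) (s : conn_string n.+1) :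
    conn_string n :=
  if s is Some s then
    if ((val s).1 == i) && ((val s).2 == i) then None else
    str n (if (val s).1 <= i then (val s).1 : nat else (val s).1.-1)
          (if (val s).2 < i then (val s).2 : nat else (val s).2.-1)
  else None.

Lemma sdegen_funE (n : nat) (i : 'I_n.+1) (a b : nat) : a <= b -> b < n.+1 ->
  sdegen_fun i (str n.+1 a b) =
  if (a == i) && (b == i) then None else
  str n (if a <= i then a else a.-1) (if b < i then b else b.-1).
Proof. by move=> ab bn; rewrite (strE ab bn). Qed.

Lemma sdegen_subproof (n : nat) (i : 'I_n.+1) :
  is_string_morphism (finfun (sdegen_fun i)).
Proof.
apply: string_morphism_str => // a b c ab bc cn.
have lt_in := ltn_ord i.
rewrite !sdegen_funE; try lia.
have -> : (a == i) && (c == i) = false by lia.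
split; last by move/str_neq0; case; lia_if.
case: (boolP ((a == i) && (b == i))) => ab_i;
  case: (boolP ((b.+1 == i) && (c == i))) => bc_i; first by lia.
- by rewrite smul0s; congr str; lia_if.
- by rewrite smuls0; congr str; lia_if.
rewrite smul_str; try by lia_if.
by case: eqP => //; lia_if.
Qed.

Definition sdegen (n : nat) (i : 'I_n.+1) : @hom Sigma n.+1 n :=
  exist (fun phi => is_string_morphism phi) _ (sdegen_subproof i).

Lemma sdegen_simple (n : nat) (i : 'I_n.+1) (j : 'I_n.+1) :
  val (sdegen i) (simple j) =
  if j < i then str n j j
  else if j == i then None
  else str n j.-1 j.-1.
Proof.
rewrite ffunE sdegen_funE // andbb -[j == i]/(val j == val i).
by case: (ltngtP (val j) i).
Qed.

Definition alpha : @hom Delta 0 1 := face ord0.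

(* The assignments on generators, for a family with object map n |-> n.-1;
   delta_n^i and sigma_n^i with n >= 1 are [sface] and [sdegen] at n.-1. *)
Definition standard_assignment
    (p : forall m n : Delta, hom m n -> @hom Sigma m.-1 n.-1) : Prop :=
  [/\ forall (n : nat) (i : 'I_n.+2), p _ _ (face i) = sface i,
      p _ _ (@face 0 ord0) = idm (0 : Sigma)
    & forall (n : nat) (i : 'I_n.+1), p _ _ (degen i) = sdegen i].

(* Main.v *)
(** Regard [n + 1] as the set of cut points of the string of length [n], so
    that a pair of cut points [a < b] is the basic string [(a, b - 1)] and a
    pair [a = b] is the zero string. An order-preserving map of cut points then
    induces a morphism of strings, which is [p]. A morphism of strings comes
    from a map of cut points, which is unique unless the morphism is zero, in
    which case it comes from all constant maps. Inverting [alpha : 0 -> 1]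
    identifies all maps [1 -> n], hence all constant maps, and nothing more:
    up to the isomorphism [0 ~ 1] each morphism of the localization is the
    image of a morphism of Delta. *)
From mathcomp Require Import all_boot boolp zify.
Require Import Defs.

Set Implicit Arguments.
Unset Strict Implicit.
Unset Printing Implicit Defensive.

(** * Functors and equivalences of categories *)

Lemma is_iso_id (C : category) (x : C) : is_iso (idm x).
Proof. by exists (idm x); rewrite comp_idl. Qed.

Lemma fmap_id (C D : category) (F : functor C D) (x : C) :
  fmap F (idm x) = idm (F x).
Proof. by case: (fmapP F). Qed.

Lemma fmap_comp (C D : category) (F : functor C D) (x y z : C)
    (g : hom y z) (f : hom x y) :
  fmap F (comp g f) = comp (fmap F g) (fmap F f).
Proof. by case: (fmapP F). Qed.

(** Choice gives every [d] an object [G0 d] and an isomorphism [e d] from its image. The inverse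
    functor lifts the conjugate of a morphism by [e]; its laws and the unit are checked after
    applying [F], by faithfulness, and the counit is [e] itself. *)
Lemma fully_faithful_equivalence (C D : category) (F : functor C D) :
  (forall (x y : C) (f g : hom x y), fmap F f = fmap F g -> f = g) ->
  (forall (x y : C) (g : hom (F x) (F y)), exists f, fmap F f = g) ->
  (forall d : D, exists c (e : hom (F c) d), is_iso e) ->
  is_equivalence F.
Proof.
move=> faithful full esurj.
have [G0 /all_tag[e /all_sig[e' eP]]] : {G0 : D -> C &
    forall d, {e : hom (F (G0 d)) d & {e' : hom d (F (G0 d)) |
      comp e' e = idm _ /\ comp e e' = idm _}}}.
  suff h d : {c : C & {e : hom (F c) d & {e' : hom d (F c) |
      comp e' e = idm _ /\ comp e e' = idm _}}}.
    by exists (fun d => projT1 (h d)) => d; exact: projT2 (h d).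
  have [c /cid[e /cid[e' eP]]] := cid (esurj d).
  by exists c, e, e'.
have e'e d : comp (e' d) (e d) = idm _ by case: (eP d).
have ee' d : comp (e d) (e' d) = idm _ by case: (eP d).
pose lift x y g := sval (cid (full x y g)).
have liftE x y g : fmap F (lift x y g) = g := svalP (cid (full x y g)).
pose G1 (x y : D) (f : hom x y) := lift _ _ (comp (e' y) (comp f (e x))).
have G1P : is_functor G1.
  split=> [x | x y z g f]; apply: faithful; rewrite ?fmap_comp !liftE.
    by rewrite comp_idl e'e fmap_id.
  by rewrite -!comp_assoc (comp_assoc (e y)) ee' comp_idl.
exists (Functor G1P); split.
  exists (fun x => lift _ _ (e (F x))); split=> [x | x y f] /=.
    exists (lift _ _ (e' (F x))).
    by split; apply: faithful; rewrite fmap_comp !liftE fmap_id.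
  apply: faithful; rewrite !fmap_comp !liftE.
  by rewrite comp_assoc ee' comp_idl.
exists e; split=> [x | x y f] /=; first by exists (e' x).
by rewrite liftE comp_assoc ee' comp_idl.
Qed.

(** * Universal property of the localization *)

Fixpoint word_lift (C D : category) (a b : C) (F0 : C -> D)
    (F1 : forall x y, hom x y -> hom (F0 x) (F0 y)) (beta : hom (F0 b) (F0 a))
    (x y : C) (u : word a b x y) : hom (F0 x) (F0 y) :=
  match u with
  | wgen _ _ f => F1 _ _ f
  | winv => beta
  | wcomp _ _ _ v w => comp (word_lift F1 beta v) (word_lift F1 beta w)
  end.

Definition loc_lift (C D : category) (a b : C) (alpha : hom a b) (F0 : C -> D)
    (F1 : forall x y, hom x y -> hom (F0 x) (F0 y)) (beta : hom (F0 b) (F0 a))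
    (x y : localization alpha) (q : hom x y) : hom (F0 x) (F0 y) :=
  word_lift F1 beta (loc_repr q).

(** Each rule generating the congruence holds in [D] as soon as [beta] is a two-sided inverse of the
    image of [alpha]. Hence [loc_lift] does not depend on the representative that it evaluates. *)
Lemma word_lift_weq (C D : category) (a b : C) (alpha : hom a b) (F0 : C -> D)
    (F1 : forall x y, hom x y -> hom (F0 x) (F0 y)) (beta : hom (F0 b) (F0 a))
    (x y : C) (u v : word a b x y) :
  is_functor F1 -> comp beta (F1 _ _ alpha) = idm _ ->
  comp (F1 _ _ alpha) beta = idm _ ->
  weq alpha u v -> word_lift F1 beta u = word_lift F1 beta v.
Proof.
move=> [F1_id F1_comp] beta_l beta_r; elim=> //=.
- by move=> ? ? ? ? ? _ -> _ ->.
- by move=> ? ? ? ? ? ? ? _ -> _ ->.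
- by move=> ? ? ?; rewrite F1_id comp_idl.
- by move=> ? ? ?; rewrite F1_id comp_idr.
- by move=> *; rewrite comp_assoc.
- by rewrite F1_id.
- by rewrite F1_id.
Qed.

Lemma loc_lift_class (C D : category) (a b : C) (alpha : hom a b) (F0 : C -> D)
    (F1 : forall x y, hom x y -> hom (F0 x) (F0 y)) (beta : hom (F0 b) (F0 a))
    (x y : C) (u : word a b x y) :
  is_functor F1 -> comp beta (F1 _ _ alpha) = idm _ ->
  comp (F1 _ _ alpha) beta = idm _ ->
  loc_lift F1 beta (loc_class alpha u : @hom (localization alpha) x y) =
  word_lift F1 beta u.
Proof.
move=> F1P beta_l beta_r; apply: word_lift_weq beta_l beta_r _ => //.
by apply/loc_classP; rewrite loc_reprK.
Qed.

Lemma loc_lift_functor (C D : category) (a b : C) (alpha : hom a b)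
    (F0 : C -> D) (F1 : forall x y, hom x y -> hom (F0 x) (F0 y))
    (beta : hom (F0 b) (F0 a)) :
  is_functor F1 -> comp beta (F1 _ _ alpha) = idm _ ->
  comp (F1 _ _ alpha) beta = idm _ ->
  is_functor (loc_lift F1 beta : forall x y : localization alpha, _).
Proof.
move=> F1P beta_l beta_r; split=> [x | x y z g f].
  by rewrite loc_lift_class //=; case: F1P.
by rewrite [LHS]loc_lift_class.
Qed.

Lemma loc_class_comp (C : category) (a b : C) (alpha : hom a b) (x y z : C)
    (u : word a b y z) (v : word a b x y) :
  loc_class alpha (wcomp u v) =
  @comp (localization alpha) x y z (loc_class alpha u) (loc_class alpha v).
Proof. by rewrite /= loc_compE. Qed.

(** Words are built from morphisms of [C] and the formal inverse. The value at the latter is forced,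
    because inverses of the common value at [alpha] are unique. *)
Lemma loc_functor_ext (C D : category) (a b : C) (alpha : hom a b)
    (F0 : C -> D)
    (F G : forall x y : localization alpha, hom x y -> hom (F0 x) (F0 y)) :
  is_functor F -> is_functor G ->
  (forall (x y : C) (f : hom x y),
     F x y (loc_map alpha f) = G x y (loc_map alpha f)) ->
  forall (x y : localization alpha) (q : hom x y), F x y q = G x y q.
Proof.
move=> [F_id F_comp] [G_id G_comp] FG x y q; rewrite -[q]loc_reprK.
elim: (loc_repr q) => {x y q} [x y f | | x y z u IHu v IHv].
- exact: FG.
- have [w [wl wr]] := loc_map_iso alpha.
  have -> : loc_class alpha (winv a b) = w.
    rewrite -[LHS](comp_idr (c := localization alpha)) -wr.
    rewrite [LHS](comp_assoc (c := localization alpha)).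
    rewrite [X in comp X _](_ : _ = idm (a : localization alpha)).
      by rewrite comp_idl.
    by rewrite /= /loc_map loc_compE; apply/loc_classP; exact: weq_invl.
  rewrite -[LHS]comp_idr -[X in comp _ X]G_id -wr G_comp -FG.
  by rewrite comp_assoc -F_comp wl F_id comp_idl.
- by rewrite loc_class_comp F_comp G_comp IHu IHv.
Qed.

(** * Order-preserving maps as functions on natural numbers *)

(* The values of [f] as a function on nat; the junk value outside of the
   domain is 0. *)
Definition order_nat (m n : nat) (f : order_map m n) (k : nat) : nat :=
  if insub k is Some i then val (val f i) else 0.

Lemma order_natE (m n : nat) (f : order_map m n) (i : 'I_m) :
  order_nat f i = val f i.
Proof. by rewrite /order_nat valK. Qed.

Lemma order_nat_lt (m n : nat) (f : order_map m n) (k : nat) :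
  k < m -> order_nat f k < n.
Proof. by move=> km; rewrite (order_natE f (Ordinal km)). Qed.

Lemma order_nat_mono (m n : nat) (f : order_map m n) (j k : nat) :
  j <= k -> k < m -> order_nat f j <= order_nat f k.
Proof.
move=> jk km; rewrite (order_natE f (Ordinal (leq_ltn_trans jk km))).
by rewrite (order_natE f (Ordinal km)); apply: (order_mapP _ (valP f)).
Qed.

Lemma order_nat_inj (m n : nat) (f g : order_map m n) :
  (forall k, k < m -> order_nat f k = order_nat g k) -> f = g.
Proof.
move=> fg; apply/val_inj/ffunP => i; apply: val_inj.
by have := fg i (ltn_ord i); rewrite !order_natE.
Qed.

Lemma order_nat_id (n k : nat) : k < n -> order_nat (order_map_id n) k = k.
Proof. by move=> kn; rewrite (order_natE _ (Ordinal kn)) ffunE. Qed.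

Lemma order_nat_comp (l m n : nat) (g : order_map m n) (f : order_map l m)
    (k : nat) : k < l ->
  order_nat (order_map_comp g f) k = order_nat g (order_nat f k).
Proof.
by move=> kl; rewrite !(order_natE _ (Ordinal kl)) order_natE ffunE.
Qed.

Lemma order_nat_face (n : nat) (i : 'I_n.+1) (k : nat) :
  k < n -> order_nat (face i) k = bump i k.
Proof. by move=> kn; rewrite (order_natE _ (Ordinal kn)) ffunE. Qed.

Lemma order_nat_degen (n : nat) (i : 'I_n) (k : nat) : k < n.+1 ->
  order_nat (degen i) k = if k <= i then k else k.-1.
Proof. by move=> kn; rewrite (order_natE _ (Ordinal kn)) ffunE. Qed.

Lemma order_nat_surj (m n : nat) (F : nat -> nat) :
  (forall j k, j <= k -> k < m -> F j <= F k) ->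
  (forall k, k < m -> F k < n) ->
  exists f : order_map m n, forall k, k < m -> order_nat f k = F k.
Proof.
move=> F_mono F_lt.
pose h := [ffun i : 'I_m => Ordinal (F_lt i (ltn_ord i))].
have hP : order_preserving h.
  by apply/order_mapP => i j ij; rewrite !ffunE; apply: F_mono.
exists (exist (fun f => order_preserving f) h hP) => k km.
by rewrite (order_natE _ (Ordinal km)) ffunE.
Qed.

Lemma order_map_const (m n c : nat) : c < n ->
  exists f : order_map m n, forall k, k < m -> order_nat f k = c.
Proof. by move=> cn; exact: (order_nat_surj (F := fun=> c)). Qed.

(** * Faces and degeneracies generate the simplex category *)

(** Induction on [m + n]: a map identifying two neighbours factors through a degeneracy, a strictly
    increasing map missing a value factors through a face, and a strictly increasing map missing
    nothing is an identity. *)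
Lemma Delta_ind (P : forall m n : Delta, hom m n -> Prop) :
  (forall n, P n n (idm n)) ->
  (forall l m n (g : hom m n) (f : hom l m),
     P _ _ g -> P _ _ f -> P _ _ (comp g f)) ->
  (forall (n : nat) (i : 'I_n.+1), P _ _ (face i)) ->
  (forall (n : nat) (i : 'I_n), P _ _ (degen i)) ->
  forall m n (f : hom m n), P m n f.
Proof.
move=> P_id P_comp P_face P_degen m n f.
move: {2}(m + n) (leqnn (m + n)) => N; elim: N m n f => [|N IHN] m n f leN.
  have [m0 n0] : m = 0 /\ n = 0 by lia.
  rewrite {}m0 {}n0 in f leN *.
  by have -> : f = idm (0 : Delta) by exact: order_nat_inj.
have [[j [jm fj]] | f_inj] :=
    pselect (exists j, j.+1 < m /\ order_nat f j = order_nat f j.+1).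
  case: m => // m in f leN jm fj *.
  pose i : 'I_m := Ordinal (jm : j < m).
  (* The face missing j + 1 is a section of [degen i]. The composite of the two moves only j + 1, to
     j, where [f] takes the same value. *)
  suff -> : f = @comp Delta _ _ _
      (order_map_comp f (face (lift ord0 i))) (degen i).
    apply: P_comp => //; apply: (IHN _ _ (order_map_comp _ _)); lia.
  apply: order_nat_inj => k km.
  have dk : order_nat (degen i) k < m by exact: order_nat_lt.
  rewrite !order_nat_comp // order_nat_face //.
  rewrite order_nat_degen // /bump /= /bump.
  have [-> | kj] := eqVneq k j.+1; last by congr order_nat; case: ifP; lia.
  rewrite -fj; congr order_nat; case: ifP; lia.
have f_lt j k : j < k -> k < m -> order_nat f j < order_nat f k.
  elim: k => // k IHk; rewrite ltnS leq_eqVlt => jk km.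
  have lt_k : order_nat f k < order_nat f k.+1.
    rewrite ltn_neqAle order_nat_mono // andbT.
    by apply/eqP => fk; apply: f_inj; exists k.
  case/orP: jk => [/eqP-> // | jk].
  exact: ltn_trans (IHk jk (ltnW km)) lt_k.
have [[i0 i0P] | f_surj] :=
    pselect (exists i : 'I_n, forall k, k < m -> order_nat f k <> i).
  case: n => [|n] in f leN f_inj f_lt i0 i0P *; first by case: i0 i0P.
  have [f' f'E] : exists f' : order_map m n,
      forall k, k < m -> order_nat f' k = unbump i0 (order_nat f k).
    apply: order_nat_surj => [j k jk km | k km].
      rewrite /unbump; have := order_nat_mono f jk km.
      have := i0P k km; have := i0P j (leq_ltn_trans jk km); lia.
    have := order_nat_lt f km; have := i0P k km; have := ltn_ord i0.
    rewrite /unbump; lia.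
  suff -> : f = @comp Delta _ _ _ (face i0) f'.
    by apply: P_comp => //; apply: IHN; lia.
  apply: order_nat_inj => k km; rewrite order_nat_comp //.
  rewrite order_nat_face ?order_nat_lt // f'E // unbumpK //.
  by rewrite inE; apply/eqP/i0P.
have f_id k : k < m -> order_nat f k = k.
  elim/ltn_ind: k => k IHk km; apply/eqP; rewrite eqn_leq; apply/andP; split.
    (* If [f] sent k above k, it would miss k: smaller arguments are fixed, and all others have
       values at least that of k. *)
    rewrite leqNgt; apply/negP => kf.
    apply: f_surj.
    exists (Ordinal (ltn_trans kf (order_nat_lt f km))) => j jm /= fj.
    case: (ltngtP j k) => [jk | kj | jk].
    - have := IHk j jk jm; lia.
    - have := f_lt k j kj jm; lia.
    - by rewrite jk in fj; lia.
  case: k => // k in IHk km *.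
  by rewrite -{1}(IHk k (ltnSn k) (ltnW km)); apply: f_lt.
have mn : m = n.
  apply/eqP; rewrite eqn_leq; apply/andP; split; rewrite leqNgt; apply/negP.
    move=> nm; have := order_nat_lt f nm; rewrite f_id //; lia.
  move=> mn; apply: f_surj; exists (Ordinal mn) => k km /=.
  by rewrite f_id //; lia.
rewrite {}mn in f f_id leN f_inj f_lt f_surj *.
suff -> : f = idm (n : Delta) by exact: P_id.
by apply: order_nat_inj => k kn; rewrite f_id // order_nat_id.
Qed.

(** * Cut points and the functor [p] *)

(* The string between the cut points [a] and [b]. *)
Definition cut (n a b : nat) : conn_string n :=
  if a < b then str n a b.-1 else None.

Lemma cutS (n a b : nat) : a <= b -> cut n a b.+1 = str n a b.
Proof. by rewrite /cut ltnS => ->. Qed.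

(** The bound [b <= n] rules out the zero string that [str] returns out of range, so that a zero
    string means an empty interval. *)
Lemma cut_eq0 (n a b : nat) : b <= n -> cut n a b = None -> b <= a.
Proof.
move=> bn; rewrite /cut; case: ltnP => // ab /str_neq0.
by case; lia.
Qed.

Lemma cutnn (n a : nat) : cut n a a = None.
Proof. by rewrite /cut ltnn. Qed.

(** In terms of cut points the product is concatenation of adjacent intervals, and a zero factor is
    just an empty interval. *)
Lemma smul_cut (n a b c : nat) : a <= b -> b <= c -> c <= n ->
  smul (cut n a b) (cut n b c) = cut n a c.
Proof.
rewrite leq_eqVlt => /orP[/eqP-> | ab]; first by rewrite cutnn smul0s.
rewrite leq_eqVlt => /orP[/eqP-> | bc] cn; first by rewrite cutnn smuls0.
rewrite /cut ab bc (ltn_trans ab bc) smul_str; try lia.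
by case: eqP => //; lia.
Qed.

Lemma cut_inj (n a b c d : nat) : a < b -> b <= n -> d <= n ->
  cut n a b = cut n c d -> a = c /\ b = d.
Proof.
move=> ab bn dn; rewrite /cut ab; case: ltnP => cd.
  by move/str_inj => [||||-> bd]; lia.
by move/str_neq0; case; lia.
Qed.

(** The string (a, b) lies between the cut points a and b + 1, hence the successor at the second
    endpoint only. *)
Definition cut_map_fun (m n : nat) (f : order_map m n)
    (s : conn_string m.-1) : conn_string n.-1 :=
  if s is Some s then
    cut n.-1 (order_nat f (val s).1) (order_nat f (val s).2.+1)
  else None.

Lemma cut_map_fun_cut (m n : nat) (f : order_map m n) (a b : nat) :
  a <= b -> b <= m.-1 ->
  cut_map_fun f (cut m.-1 a b) = cut n.-1 (order_nat f a) (order_nat f b).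
Proof.
rewrite leq_eqVlt => /orP[/eqP-> | ab bm]; first by rewrite !cutnn.
case: b ab bm => // b ab bm.
by rewrite cutS // (strE (b := b) ab bm).
Qed.

Lemma order_nat_bound (m n : nat) (f : order_map m n) (k : nat) :
  k < m -> order_nat f k <= n.-1.
Proof. by move=> km; have := order_nat_lt f km; lia. Qed.

(** Multiplicativity is concatenation at the image of the middle cut point. If [f] identifies the
    outer cut points, then by monotonicity it identifies the middle one with them, which gives the
    second condition. *)
Lemma cut_map_subproof (m n : nat) (f : order_map m n) :
  is_string_morphism (finfun (cut_map_fun f)).
Proof.
apply: string_morphism_str => // a b c ab bc cm.
rewrite -!cutS ?(ltnW bc) ?(leq_trans ab (ltnW bc)) //.
rewrite !cut_map_fun_cut; try lia.
have fab : order_nat f a <= order_nat f b.+1 by apply: order_nat_mono; lia.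
have fbc : order_nat f b.+1 <= order_nat f c.+1.
  by apply: order_nat_mono; lia.
have fcn : order_nat f c.+1 <= n.-1 by apply: order_nat_bound; lia.
split; first by rewrite smul_cut.
move/(cut_eq0 fcn) => fca; rewrite /cut.
by split; case: ltnP => //; lia.
Qed.

Definition cut_map (m n : Delta) (f : hom m n) : @hom Sigma m.-1 n.-1 :=
  exist (fun phi => is_string_morphism phi) _ (cut_map_subproof f).

Lemma cut_map_cut (m n : nat) (f : order_map m n) (a b : nat) :
  a <= b -> b <= m.-1 ->
  val (cut_map f) (cut m.-1 a b) =
  cut n.-1 (order_nat f a) (order_nat f b).
Proof. by move=> ab bm; rewrite ffunE cut_map_fun_cut. Qed.

Lemma string_morphism_cut_ext (m n : nat) (phi psi : string_morphism m n) :
  (forall a, a < m -> val phi (cut m a a.+1) = val psi (cut m a a.+1)) ->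
  phi = psi.
Proof.
move=> phi_psi; apply: string_morphism_ext => i.
by rewrite /simple -cutS // phi_psi.
Qed.

Lemma cut_map_functor : is_functor cut_map.
Proof.
split=> [n | l m n g f]; apply: string_morphism_cut_ext => a al.
  by rewrite [LHS]cut_map_cut // ffunE !order_nat_id //; lia.
have fa : order_nat f a <= order_nat f a.+1 by apply: order_nat_mono; lia.
have fl : order_nat f a.+1 <= m.-1 by apply: order_nat_bound; lia.
rewrite [LHS]cut_map_cut // !order_nat_comp; try lia.
by rewrite ffunE cut_map_cut // cut_map_cut.
Qed.

(** Skipping the cut point i stretches the letter that ends at i over two letters; identifying the
    cut points i and i + 1 kills the letter s_i. *)
Lemma cut_map_standard : standard_assignment cut_map.
Proof.
split=> [n i | | n i]; apply: string_morphism_cut_ext => // a an;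
  rewrite [LHS]cut_map_cut // cutS // ffunE.
  rewrite !order_nat_face; try lia.
  have bump_lt : bump i a <= (bump i a.+1).-1 by rewrite /bump; lia.
  have bump_gt0 : 0 < bump i a.+1 by rewrite /bump; lia.
  rewrite -(prednK bump_gt0) cutS // sface_funE //.
  by rewrite /bump; congr str; case: ifP; lia.
rewrite !order_nat_degen; try by move: an => /=; lia.
rewrite sdegen_funE //.
case: (ltngtP a i) => [ai | ia | ai] /=.
- by rewrite cutS.
- by rewrite -[in LHS](ltn_predK ia) cutS.
- by rewrite ai cutnn.
Qed.

Lemma cut_map_unique (q : forall m n : Delta, hom m n -> @hom Sigma m.-1 n.-1) :
  is_functor q -> standard_assignment q ->
  forall (m n : Delta) (f : hom m n), q m n f = cut_map f.
Proof.
move=> [q_id q_comp] [q_face q_face0 q_degen].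
have [p_id p_comp] := cut_map_functor.
have [p_face p_face0 p_degen] := cut_map_standard.
apply: Delta_ind => [n | l m n g f qg qf | [|n] i | [|n] i].
- by rewrite q_id p_id.
- by rewrite q_comp qg qf p_comp.
- by rewrite (ord1 i) q_face0 p_face0.
- by rewrite q_face p_face.
- by case: i.
- by rewrite q_degen p_degen.
Qed.

(** * Morphisms of strings come from maps of cut points *)

(* If [phi] is nonzero, all nonzero images of initial strings start at the
   same point [A], and [F k] is the end of the image of the first [k] letters,
   or [A] if that image is zero. *)
Lemma string_morphism_cut_points (m n : nat) (phi : string_morphism m n) :
  exists F : nat -> nat,
    (forall j k, j <= k -> k <= m -> F j <= F k) /\
    (forall k, k <= m -> F k <= n) /\
    (forall k, k < m -> val phi (cut m k k.+1) = cut n (F k) (F k.+1)).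
Proof.
case/is_string_morphismP: (valP phi) => phi_mul phi_zero.
have phi0 := string_morphism0 (valP phi).
(* Both conditions on [phi] are restated for intervals, now allowing empty ones. *)
have phi_cat a b c : a <= b -> b <= c -> c <= m ->
    val phi (cut m a c) = smul (val phi (cut m a b)) (val phi (cut m b c)).
  rewrite leq_eqVlt => /orP[/eqP-> | ab]; first by rewrite cutnn phi0.
  rewrite leq_eqVlt => /orP[/eqP-> | bc] cm.
    by rewrite cutnn phi0 smuls0.
  rewrite -phi_mul ?smul_cut //; try lia.
  apply: smul_composable; rewrite smul_cut; try lia.
  by move/cut_eq0; lia.
have phi_cat0 a b c : a <= b -> b <= c -> c <= m ->
    val phi (cut m a c) = None ->
    val phi (cut m a b) = None /\ val phi (cut m b c) = None.
  move=> ab bc cm phi_ac.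
  have [ac | ac] := leqP c a.
    have [-> ->] : a = b /\ c = b by lia.
    by rewrite cutnn phi0.
  apply: phi_zero; rewrite smul_cut //.
  by move/cut_eq0; lia.
have cutP (s : conn_string n) :
    s = None \/ exists a b, [/\ a < b, b <= n & s = cut n a b].
  have [-> | [a [b [ab bn ->]]]] := conn_stringP s; first by left.
  by right; exists a, b.+1; rewrite cutS.
have [A [An start]] : exists A, A <= n /\ forall k, k <= m ->
    exists2 B, A <= B <= n & val phi (cut m 0 k) = cut n A B.
  have [phi_m | [A [B [AB Bn phi_m]]]] := cutP (val phi (cut m 0 m)).
    (* If the whole string goes to zero, so does every initial string, and [A] may be any point. *)
    exists 0; split=> // k km; exists 0 => //; rewrite cutnn.
    by have [] := phi_cat0 0 k m isT km (leqnn m) phi_m.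
  exists A; split=> [|k km]; first by lia.
  have [phi_k | [a [b [ab bn phi_k]]]] := cutP (val phi (cut m 0 k)).
    by exists A; rewrite ?cutnn //; lia.
  (* The nonzero image of the whole string is a product with first factor the image of the initial
     string, so both start at the same point. *)
  suff aA : a = A by rewrite -aA; exists b => //; lia.
  have := phi_cat 0 k m isT km (leqnn m); rewrite phi_m phi_k.
  have [-> | [c [d [cd dn ->]]]] := cutP (val phi (cut m k m)).
    by rewrite smuls0 => /cut_inj[]; lia.
  have [bc | bc] := eqVneq b c.
    by rewrite -bc smul_cut; [move=> /cut_inj[] | | |]; lia.
  rewrite {2 3}/cut ab cd smul_str; try lia.
  by case: eqP => [|_ /cut_eq0]; lia.
have /boolp.choice[F FP] : forall k, exists B, k <= m ->
    A <= B <= n /\ val phi (cut m 0 k) = cut n A B.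
  move=> k; have [km | km] := leqP k m; last by exists 0.
  by have [B AB phi_k] := start k km; exists B.
have F0 : F 0 = A.
  have [/andP[AF Fn]] := FP 0 isT.
  by rewrite cutnn phi0 => /esym/cut_eq0; lia.
have step k : k < m -> F k <= F k.+1 /\
    val phi (cut m k k.+1) = cut n (F k) (F k.+1).
  move=> km; have [/andP[AF Fn] phi_k] := FP k (ltnW km).
  have [/andP[AF' Fn'] phi_k1] := FP k.+1 km.
  have := phi_cat 0 k k.+1 isT (leqnSn k) km; rewrite phi_k phi_k1.
  have [-> | [c [d [cd dn phi_c]]]] := cutP (val phi (cut m k k.+1)).
    rewrite smuls0 => eqF; suff -> : F k.+1 = F k by rewrite cutnn.
    move: AF' eqF; rewrite leq_eqVlt => /orP[/eqP <- | AF'].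
      by rewrite cutnn => /esym/cut_eq0; lia.
    by move=> /cut_inj[]; lia.
  rewrite phi_c; move: AF; rewrite leq_eqVlt => /orP[/eqP <- | AF].
    rewrite cutnn smul0s => /esym eqF; have [] := cut_inj cd dn Fn' eqF.
    by move=> <- <-; split=> //; lia.
  have [Fc | Fc] := eqVneq (F k) c; first subst c.
    have Ad : A < d by lia.
    rewrite smul_cut; try lia.
    by move/esym/(cut_inj Ad dn Fn') => [_ <-]; split=> //; lia.
  (* If the images of the initial string and of the next letter do not match up, their product is
     zero. The second condition on [phi] then sends the letter to zero, contrary to [phi_c]. *)
  have -> : smul (cut n A (F k)) (cut n c d) = None.
    rewrite /cut AF cd smul_str; try lia.
    by case: eqP => //; lia.
  move=> phi0k1; have [] := phi_cat0 0 k k.+1 isT (leqnSn k) km.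
    by rewrite phi_k1.
  by move=> _; rewrite phi_c => /cut_eq0; lia.
exists F; split=> [j k jk|]; last first.
  by split=> k km; [have [/andP[]] := FP k km | have [] := step k km].
elim: k jk => [|k IHk]; first by rewrite leqn0 => /eqP->.
rewrite leq_eqVlt => /orP[/eqP-> // | jk] km.
have [Fk _] := step k km; apply: leq_trans Fk; apply: IHk => //; lia.
Qed.

Lemma cut_map_full (m n : nat) (phi : string_morphism m n) :
  exists f : order_map m.+1 n.+1, @cut_map m.+1 n.+1 f = phi.
Proof.
have [F [F_mono [F_le phiE]]] := string_morphism_cut_points phi.
have [f fE] : exists f : order_map m.+1 n.+1,
    forall k, k < m.+1 -> order_nat f k = F k.
  by apply: order_nat_surj => [j k | k]; rewrite !ltnS; auto.
exists f; apply: string_morphism_cut_ext => a am.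
by rewrite [LHS]cut_map_cut // phiE // !fE; try lia.
Qed.

(** Two cut points separated by [f] bound a string with nonzero image, whose ends recover [f] at
    both. If [f] separates 0 and m - 1, every point is separated from one of these, so [f] is
    recovered; otherwise [f] is constant. *)
Lemma cut_map_faithful (m n : nat) (f g : order_map m n) :
  cut_map f = cut_map g -> f = g \/
  (forall j k, j < m -> k < m -> order_nat f j = order_nat f k) /\
  (forall j k, j < m -> k < m -> order_nat g j = order_nat g k).
Proof.
move=> fg.
have sep (f1 g1 : order_map m n) : cut_map f1 = cut_map g1 ->
    forall j k, j <= k -> k < m -> order_nat f1 j < order_nat f1 k ->
    order_nat f1 j = order_nat g1 j /\ order_nat f1 k = order_nat g1 k.
  move=> fg1 j k jk km f_jk.
  have km' : k <= m.-1 by lia.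
  have := cut_map_cut f1 jk km'; rewrite fg1 cut_map_cut // => /esym.
  by apply: cut_inj => //; exact: order_nat_bound.
have const (f1 : order_map m n) : order_nat f1 0 = order_nat f1 m.-1 ->
    forall j k, j < m -> k < m -> order_nat f1 j = order_nat f1 k.
  move=> f1_const; suff h k : k < m -> order_nat f1 k = order_nat f1 0.
    by move=> j k /h-> /h->.
  move=> km; apply/eqP; rewrite eqn_leq {1}f1_const.
  by apply/andP; split; apply: order_nat_mono; lia.
have eq_of (f1 g1 : order_map m n) : cut_map f1 = cut_map g1 -> 0 < m ->
    order_nat f1 0 < order_nat f1 m.-1 -> f1 = g1.
  move=> fg1 m0 f1_lt; apply: order_nat_inj => k km.
  have [f1k | f1k] := leqP (order_nat f1 k) (order_nat f1 0).
    have [] := sep _ _ fg1 k m.-1; try lia.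
  by have [] := sep _ _ fg1 0 k.
have [m0 | m_gt0] := posnP m.
  by left; apply: order_nat_inj => k; rewrite [X in _ < X]m0.
have m1 : m.-1 < m by lia.
have := order_nat_mono f (leq0n _) m1; have := order_nat_mono g (leq0n _) m1.
rewrite leq_eqVlt => /orP[/eqP/const g_const | g_lt]; last first.
  by left; apply/esym/eq_of.
rewrite leq_eqVlt => /orP[/eqP/const f_const | f_lt]; last by left; apply: eq_of.
by right.
Qed.

(** * The induced functor on the localization *)

(** Sigma_0 has no letters, so its only endomorphism is the identity, and [alpha] becomes
    invertible. *)
Lemma cut_map_alpha_l :
  comp (idm (0 : Sigma)) (cut_map alpha) = idm (0 : Sigma).
Proof. by apply: string_morphism_cut_ext. Qed.

Lemma cut_map_alpha_r :
  comp (cut_map alpha) (idm (0 : Sigma)) = idm (0 : Sigma).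
Proof. by apply: string_morphism_cut_ext. Qed.

Definition pbar (m n : localization alpha) (q : hom m n) :
    @hom Sigma m.-1 n.-1 :=
  @loc_lift Delta Sigma 0 1 alpha (fun n => n.-1) cut_map
    (idm (0 : Sigma)) m n q.

Lemma pbar_functor : is_functor pbar.
Proof.
exact: (@loc_lift_functor Delta Sigma 0 1 alpha (fun n => n.-1) _ _
  cut_map_functor cut_map_alpha_l cut_map_alpha_r).
Qed.

Lemma pbar_loc_map (m n : Delta) (f : hom m n) :
  pbar (loc_map alpha f) = cut_map f.
Proof.
exact: (@loc_lift_class Delta Sigma 0 1 alpha (fun n => n.-1) _ _ _ _ _
  cut_map_functor cut_map_alpha_l cut_map_alpha_r).
Qed.

(** * Normal forms in the localization *)

(** As [n.-1.+1] is n for n > 0 and 1 for n = 0, this replaces the object [0] by the isomorphic [1]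
    and keeps all others. *)
Definition from_pos (n : nat) : @hom (localization alpha) n.-1.+1 n :=
  match n with
  | 0 => loc_class alpha (winv (0 : Delta) 1)
  | n.+1 => idm (n.+1 : localization alpha)
  end.

Lemma from_pos_iso (n : nat) : is_iso (from_pos n).
Proof.
case: n => [|n]; last exact: is_iso_id.
exists (loc_map alpha alpha); rewrite /= /loc_map !loc_compE.
by split; apply/loc_classP; [exact: weq_invr | exact: weq_invl].
Qed.

Lemma pbar_from_pos (n : nat) : pbar (from_pos n) = idm (n.-1 : Sigma).
Proof.
case: n => [|n]; last by case: pbar_functor => ->.
exact: (@loc_lift_class Delta Sigma 0 1 alpha (fun n => n.-1) _ _ _ _ _
  cut_map_functor cut_map_alpha_l cut_map_alpha_r).
Qed.

Lemma loc_map_comp (l m n : Delta) (g : hom m n) (f : hom l m) :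
  loc_map alpha (comp g f) = comp (loc_map alpha g) (loc_map alpha f).
Proof. by case: (loc_map_functor alpha) => _ ->. Qed.

(* A map [c : 1 -> n] is determined in the localization by the unique map
   [c alpha : 0 -> n]. *)
Lemma loc_map_from1 (n : nat) (g : order_map 0 n) (c : order_map 1 n) :
  comp (loc_map alpha g) (from_pos 0) = loc_map alpha c.
Proof.
have -> : g = @comp Delta _ _ _ c alpha by exact: order_nat_inj.
rewrite loc_map_comp -comp_assoc.
rewrite [X in comp _ X](_ : _ = idm (1 : localization alpha)) ?comp_idr //.
by rewrite /= /loc_map loc_compE; apply/loc_classP; exact: weq_invr.
Qed.

(** Induction on words. In a composite passing through [0], a map from [0] follows the inverse of
    [alpha]; by [loc_map_from1] any map from [1] replaces the two, and one exists because [n.-1.+1]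
    is positive. *)
Lemma loc_normal_form (m n : localization alpha) (q : hom m n) :
  exists f : @hom Delta m n.-1.+1, q = comp (from_pos n) (loc_map alpha f).
Proof.
rewrite -[q]loc_reprK.
elim: (loc_repr q) => {m n q} [m [|n] f | | l m n v [g gE] u [f fE]].
(* Only [0] maps to [0], and its identity is the inverse of [alpha] after [alpha]. *)
- have m0 : m = 0.
    by case: m f => // m f; have := order_nat_lt f (ltn0Sn m).
  subst m; exists alpha; have -> : f = idm (0 : Delta) by exact: order_nat_inj.
  by rewrite /= /loc_map loc_compE; apply/esym/loc_classP; exact: weq_invl.
- by exists f; rewrite comp_idl.
- exists (idm (1 : Delta)).
  by rewrite (_ : loc_map _ _ = idm (1 : localization alpha)) ?comp_idr.
rewrite loc_class_comp gE fE.
case: m u v f g fE gE => [|m] u v f g fE gE.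
  have [c _] := order_map_const 1 (ltn0Sn n.-1).
  exists (@comp Delta _ _ _ c f); rewrite loc_map_comp -(loc_map_from1 g).
  by rewrite !comp_assoc.
exists (@comp Delta _ _ _ g f); rewrite loc_map_comp comp_idl.
by rewrite comp_assoc.
Qed.

(** A constant map factors through the map [t] to [1], and by [loc_map_from1] all maps from [1] to
    the same object have the same class. *)
Lemma loc_map_const (m n : nat) (f g : order_map m n.+1) :
  (forall j k, j < m -> k < m -> order_nat f j = order_nat f k) ->
  (forall j k, j < m -> k < m -> order_nat g j = order_nat g k) ->
  loc_map alpha f = loc_map alpha g.
Proof.
have [t _] := order_map_const m (ltn0Sn 0).
have [z _] := order_map_const 0 (ltn0Sn n).
suff factor (f1 : order_map m n.+1) :
    (forall j k, j < m -> k < m -> order_nat f1 j = order_nat f1 k) ->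
    loc_map alpha f1 =
    comp (comp (loc_map alpha z) (from_pos 0)) (loc_map alpha t).
  by move=> /factor-> /factor->.
move=> f_const; have [m0 | m_gt0] := posnP m.
  have [c _] := order_map_const 1 (ltn0Sn n).
  rewrite (loc_map_from1 z c) -loc_map_comp; congr (loc_map alpha _).
  by apply: order_nat_inj => k; rewrite [X in _ < X]m0.
have [c cE] := order_map_const 1 (order_nat_lt f1 m_gt0).
rewrite (loc_map_from1 z c) -loc_map_comp; congr (loc_map alpha _).
apply: order_nat_inj => k km.
rewrite [RHS]order_nat_comp // cE ?(order_nat_lt t) //; exact: f_const.
Qed.

(** * The equivalence *)

(** For normal forms, [cut_map_faithful] leaves only the case of two constant maps, which the
    localization identifies. *)
Lemma pbar_faithful (m n : localization alpha) (q r : hom m n) :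
  pbar q = pbar r -> q = r.
Proof.
have [[f ->] [g ->]] := (loc_normal_form q, loc_normal_form r).
have [_ pbar_comp] := pbar_functor.
rewrite !pbar_comp pbar_from_pos !pbar_loc_map.
rewrite [LHS](comp_idl (c := Sigma)) [RHS](comp_idl (c := Sigma)).
move=> fg; have [-> // | [f_const g_const]] := @cut_map_faithful m _ f g fg.
by rewrite (loc_map_const f_const g_const).
Qed.

Lemma pbar_full (m n : localization alpha) (phi : @hom Sigma m.-1 n.-1) :
  exists q : hom m n, pbar q = phi.
Proof.
have [f fE] := cut_map_full phi; have [_ pbar_comp] := pbar_functor.
have [e [_ eK]] := from_pos_iso m.
exists (comp (from_pos n) (comp (loc_map alpha f) e)).
(* [e] is inverse to [from_pos m], which [pbar] sends to an identity. *)
have pe : pbar e = idm (m.-1 : Sigma).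
  have <- : pbar (idm m) = idm (m.-1 : Sigma) by case: pbar_functor.
  rewrite -eK pbar_comp pbar_from_pos; exact/esym/comp_idl.
rewrite !pbar_comp pe pbar_from_pos pbar_loc_map fE.
by rewrite [LHS](comp_idl (c := Sigma)) [LHS](comp_idr (c := Sigma)).
Qed.

Theorem proposition3p1 :
  exists (p : forall m n : Delta, hom m n -> @hom Sigma m.-1 n.-1)
         (p_functor : is_functor p),
    [/\ standard_assignment p,
        forall q : forall m n : Delta, hom m n -> @hom Sigma m.-1 n.-1,
          is_functor q -> standard_assignment q ->
          forall (m n : Delta) (f : hom m n), q m n f = p m n f
      & exists (pbar : forall m n : localization alpha,
                         hom m n -> @hom Sigma m.-1 n.-1)
               (pbar_functor : is_functor pbar),
        [/\ forall (m n : Delta) (f : hom m n),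
              pbar m n (loc_map alpha f) = p m n f,
            forall r : forall m n : localization alpha,
                hom m n -> @hom Sigma m.-1 n.-1,
              is_functor r ->
              (forall (m n : Delta) (f : hom m n),
                 r m n (loc_map alpha f) = p m n f) ->
              forall (m n : localization alpha) (f : hom m n),
                r m n f = pbar m n f
          & is_equivalence (Functor pbar_functor)]].
Proof.
exists cut_map, cut_map_functor; split.
- exact: cut_map_standard.
- exact: cut_map_unique.
exists pbar, pbar_functor; split.
- exact: pbar_loc_map.
- move=> r r_functor rE.
  apply: (loc_functor_ext r_functor pbar_functor) => m n f.
  by rewrite rE pbar_loc_map.
apply: fully_faithful_equivalence => [m n q r | m n phi | n].
- exact: pbar_faithful.
- exact: pbar_full.
(* Sigma_n is exactly the image of [n + 1], so an identity serves as the isomorphism. *)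
- by exists (n.+1 : localization alpha), (idm n); exact: is_iso_id.
Qed.
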